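(* Let $G$ be a connected, locally finite chordal graph. There is a bijection between the set of clique trees of $G$ and the product $\prod_{F\in\mathfrak{F}(G)}\mathcal{S}\bigl(\Gamma^{=}(F)/\sim_F\bigr)$, where $\mathcal{S}(H)$ denotes the set of spanning trees of the multigraph $H$ (spanning trees using distinct parallel edges being distinguished).
   Context: A chordal graph is a loopless graph without multiple edges with no induced cycle of length greater than $3$; chordal graphs are assumed connected; locally finite means all degrees finite. A clique is a maximal complete vertex set; $\mathcal{K}(G)$ is the set of cliques; the clique graph $\mathcal{C}(G)$ has vertex set $\mathcal{K}(G)$ and an edge between distinct intersecting cliques. A clique tree of $G$ is a spanning tree $T$ of $\mathcal{C}(G)$ such that for every vertex $v$ the induced subgraph $T[\{K: v\in K\}]$ is a tree. For a complete set $C$ (possibly empty), $F(C):=\{K\in\mathcal{K}(G):C\subseteq K\}$; $\mathfrak{F}(G)$ is the set of all such clique families. For $F\in\mathfrak{F}(G)$: $\Gamma^{=}(F)$ is the graph on $F$ with an edge $K_1K_2$ (distinct, intersecting $K_1,K_2\in F$) whenever $F(K_1\cap K_2)=F$; $\Gamma^{<}(F)$ is the graph on $F$ with an edge $K_1K_2$ (distinct, intersecting) whenever $F(K_1\cap K_2)\subsetneq F$; $\sim_F$ is the equivalence relation whose classes are the connected components of $\Gamma^{<}(F)$; $\Gamma^{=}(F)/\sim_F$ is the multigraph obtained from $\Gamma^{=}(F)$ by contracting each $\sim_F$-class to a single vertex, each edge keeping its identity. *)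

(* Defs.v *)
From HB Require Import structures.
From Stdlib Require Import Relation_Operators.
From mathcomp Require Import all_boot.
From mathcomp Require Import boolp classical_sets functions cardinality.

Set Implicit Arguments.
Unset Strict Implicit.
Unset Printing Implicit Defensive.

Local Open Scope classical_set_scope.

Record sgraph := SGraph {
  svert :> Type;
  adj : svert -> svert -> Prop;
  adj_sym : forall x y, adj x y -> adj y x;
  adj_irrefl : forall x, ~ adj x x }.

(* The ends of an edge form a set of two vertices, or one for a loop. *)
Record mgraph := MGraph {
  mvert : Type;
  medge : Type;
  ends : medge -> set mvert;
  endsP : forall e, exists x y, ends e = [set x; y] }.

Definition joins (M : mgraph) (x y : mvert M) : Prop :=
  exists e : medge M, ends e = [set x; y].

Definition connected (T : Type) (R : T -> T -> Prop) : Prop :=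
  forall x y, clos_refl_trans T R x y.

(* [ordS] is the cyclic successor on ['I_k].  The case k = 1 is a loop and the
   case k = 2 a pair of parallel edges. *)
Definition is_mcycle (M : mgraph) (k : nat)
    (x : 'I_k -> mvert M) (e : 'I_k -> medge M) : Prop :=
  [/\ (0 < k)%N, injective x, injective e &
      forall i, ends (e i) = [set x i; x (ordS i)]].

Definition acyclic (M : mgraph) : Prop :=
  ~ exists k (x : 'I_k -> mvert M) (e : 'I_k -> medge M), is_mcycle x e.

Definition is_tree (M : mgraph) : Prop := connected (@joins M) /\ acyclic M.

Lemma spanning_subgraph_endsP (M : mgraph) (S : set (medge M)) (e : S) :
  exists x y, ends (val e) = [set x; y].
Proof. exact: endsP. Qed.

Definition spanning_subgraph (M : mgraph) (S : set (medge M)) : mgraph :=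
  MGraph (@spanning_subgraph_endsP M S).

Definition induced_edges (M : mgraph) (W : set (mvert M)) : set (medge M) :=
  [set e | ends e `<=` W].

Lemma induced_endsP (M : mgraph) (W : set (mvert M)) (e : induced_edges W) :
  exists x y : W, [set z : W | ends (val e) (val z)] = [set x; y].
Proof.
have eW : ends (val e) `<=` W := set_valP e.
have [x [y exy]] := endsP (val e).
have Wx : W x by apply: eW; rewrite exy; left.
have Wy : W y by apply: eW; rewrite exy; right.
exists (exist _ x (mem_set Wx)), (exist _ y (mem_set Wy)).
apply/seteqP; split=> z /=; rewrite exy.
  by case=> zE; [left | right]; apply: val_inj.
by case=> ->; [left | right].
Qed.

Definition induced (M : mgraph) (W : set (mvert M)) : mgraph :=
  MGraph (@induced_endsP M W).

(* A spanning tree is identified with its set of edges, so that trees using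
   different parallel edges are different. *)
Definition spanning_trees (M : mgraph) : set (set (medge M)) :=
  [set S | is_tree (spanning_subgraph S)].
Arguments spanning_trees : clear implicits.

Definition sedges (H : sgraph) : set (set H) :=
  [set A | exists x y, adj x y /\ A = [set x; y]].
Arguments sedges : clear implicits.

Lemma sedges_endsP (H : sgraph) (e : sedges H) :
  exists x y, val e = [set x; y].
Proof. by have [x [y [_ ->]]] := set_valP e; exists x, y. Qed.

Definition mgraph_of (H : sgraph) : mgraph := MGraph (@sedges_endsP H).

Section Contraction.
Variables (M : mgraph) (R : mvert M -> mvert M -> Prop).

Definition class_set (x : mvert M) : set (mvert M) := [set y | R x y].

Definition class_of (x : mvert M) : range class_set :=
  exist _ (class_set x) (mem_set (imageT class_set x)).

Lemma contract_endsP (e : medge M) :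
  exists x y, class_of @` ends e = [set x; y].
Proof.
have [x [y ->]] := endsP e; exists (class_of x), (class_of y).
by rewrite image_setU !image_set1.
Qed.

(* The multigraph obtained by contracting each class of the equivalence
   relation R to a single vertex; an edge inside a class becomes a loop. *)
Definition contract : mgraph := MGraph contract_endsP.

End Contraction.

Section Chordal.
Variable G : sgraph.

Definition locally_finite : Prop :=
  forall x : G, finite_set [set y | adj x y].

Definition induced_cycle (k : nat) (x : 'I_k -> G) : Prop :=
  injective x /\
  forall i j, adj (x i) (x j) <-> (j = ordS i \/ i = ordS j).

Definition chordal : Prop :=
  forall k (x : 'I_k -> G), (3 < k)%N -> ~ induced_cycle x.

Definition complete : set (set G) :=
  [set C | forall x y, C x -> C y -> x <> y -> adj x y].

Definition cliques : set (set G) :=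
  [set K | complete K /\ forall L, complete L -> K `<=` L -> L = K].

Definition clique_adj (K1 K2 : cliques) : Prop :=
  K1 <> K2 /\ val K1 `&` val K2 !=set0.

Lemma clique_adj_sym K1 K2 : clique_adj K1 K2 -> clique_adj K2 K1.
Proof. by case=> ne i; split; [exact/nesym | rewrite setIC]. Qed.

Lemma clique_adj_irrefl K : ~ clique_adj K K.
Proof. by case. Qed.

Definition clique_graph : sgraph := SGraph clique_adj_sym clique_adj_irrefl.

Definition clique_trees : set (set (medge (mgraph_of clique_graph))) :=
  [set T | spanning_trees (mgraph_of clique_graph) T /\
     forall v : G,
       is_tree (@induced (@spanning_subgraph (mgraph_of clique_graph) T)
                         [set K : cliques | val K v])].

Definition clique_family (C : set G) : set cliques :=
  [set K | C `<=` val K].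

Definition clique_families : set (set cliques) :=
  [set clique_family C | C in complete].

Section Gamma.
Variable F : set cliques.

Definition meet_family (K1 K2 : F) : set cliques :=
  clique_family (val (val K1) `&` val (val K2)).

Definition gamma_eq_adj (K1 K2 : F) : Prop :=
  clique_adj (val K1) (val K2) /\ meet_family K1 K2 = F.

Definition gamma_lt_adj (K1 K2 : F) : Prop :=
  clique_adj (val K1) (val K2) /\ meet_family K1 K2 `<` F.

Lemma gamma_eq_adj_sym K1 K2 : gamma_eq_adj K1 K2 -> gamma_eq_adj K2 K1.
Proof.
by case=> /clique_adj_sym a; rewrite /gamma_eq_adj /meet_family setIC.
Qed.

Lemma gamma_eq_adj_irrefl K : ~ gamma_eq_adj K K.
Proof. by case=> /clique_adj_irrefl. Qed.

Lemma gamma_lt_adj_sym K1 K2 : gamma_lt_adj K1 K2 -> gamma_lt_adj K2 K1.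
Proof.
by case=> /clique_adj_sym a; rewrite /gamma_lt_adj /meet_family setIC.
Qed.

Lemma gamma_lt_adj_irrefl K : ~ gamma_lt_adj K K.
Proof. by case=> /clique_adj_irrefl. Qed.

Definition gamma_eq : sgraph := SGraph gamma_eq_adj_sym gamma_eq_adj_irrefl.

Definition gamma_lt : sgraph := SGraph gamma_lt_adj_sym gamma_lt_adj_irrefl.

(* Since adjacency is symmetric, this relates two cliques exactly when they lie
   in the same connected component of [gamma_lt]. *)
Definition sim : F -> F -> Prop := clos_refl_trans F (@adj gamma_lt).

Definition gamma_quotient : mgraph := @contract (mgraph_of gamma_eq) sim.

End Gamma.

End Chordal.

Arguments cliques : clear implicits.
Arguments complete : clear implicits.
Arguments clique_trees : clear implicits.
Arguments clique_families : clear implicits.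

(* Main.v *)
Require Import Defs.
From Stdlib Require Import Relation_Operators Operators_Properties.
From mathcomp Require Import all_boot zify.
From mathcomp Require Import finmap.
From mathcomp Require Import boolp classical_sets functions cardinality.

Set Implicit Arguments.
Unset Strict Implicit.
Unset Printing Implicit Defensive.

Local Open Scope classical_set_scope.

(* Each edge K1K2 of the clique graph is an edge of Gamma^=(F) for exactly one
   clique family F, namely F(K1 :&: K2), so sets of edges of the clique graph
   correspond to families of sets of edges of the graphs Gamma^=(F).  It remains to
   see that T is a clique tree if and only if every trace of T on Gamma^=(F) is a
   spanning tree of the quotient.

   A multigraph is acyclic if and only if every function on its edges with values
   in F_2 is the coboundary of a function on its vertices, so that acyclicity can
   be glued and restricted like a cohomology class.

   If T is a clique tree, then T[F(C)], an intersection of subtrees, is connected for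
   every complete set C, and contracting the classes of ~_F, which are connected
   in T, turns T[F] into a spanning tree.  Conversely, T[F(C)] is a tree by
   induction from larger to smaller complete sets C, which have no infinite
   ascending chain by local finiteness.
   For acyclicity, coboundary potentials on the trees T[F(C + v)] are glued along
   the common neighbours v of C; the obstruction is a 1-cocycle on a chordal
   graph, and it vanishes because a shortest closed walk on which a cocycle is
   nonzero would be an induced cycle of length at least 4. *)

Lemma set2_eq (T : Type) (a b c d : T) : [set a; b] = [set c; d] ->
  (a = c /\ b = d) \/ (a = d /\ b = c).
Proof.
move=> E.
have : [set c; d] a by rewrite -E; left.
have : [set c; d] b by rewrite -E; right.
have : [set a; b] c by rewrite E; left.
have : [set a; b] d by rewrite E; right.
by move=> /= [] ? [] ? [] ? [] ?; subst; auto.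
Qed.

Lemma set2C (T : Type) (a b : T) : [set a; b] = [set b; a].
Proof. exact: setUC. Qed.

(** * Sums modulo 2 along walks, and shortest odd closed walks *)

Section Walks.
Variables (M : mgraph) (b : medge M -> bool).
Implicit Types (x y z : mvert M) (e : medge M) (s t : bool).

Definition coboundary : Prop := exists g : mvert M -> bool,
  forall e x y, ends e = [set x; y] -> g x (+) g y = b e.

(** Here [n] is the length of the walk and [s] the sum modulo 2 of [b] over its edges. *)
Fixpoint walk n x y s : Prop :=
  if n is m.+1 then
    exists z e, ends e = [set x; z] /\ walk m z y (s (+) b e)
  else x = y /\ s = false.

Lemma walk_cat m n x y z s t :
  walk m x y s -> walk n y z t -> walk (m + n) x z (s (+) t).
Proof.
elim: m x s => [|m IH] x s /=; first by case=> -> ->.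
case=> w [e [xe /IH wy]] /wy; rewrite addbAC => ?.
by exists w, e.
Qed.

Lemma walk1 e x y : ends e = [set x; y] -> walk 1 x y (b e).
Proof. by move=> xe; exists y, e; rewrite /= addbb. Qed.

Lemma walk_rev n x y s : walk n x y s -> walk n y x s.
Proof.
elim: n x s => [|n IH] x s /=; first by case=> -> ->.
case=> z [e [xe /IH w]]; rewrite set2C in xe.
by have := walk_cat w (walk1 xe); rewrite addn1 -addbA addbb addbF.
Qed.

Lemma walk_nth (p : nat -> mvert M) (e : nat -> medge M) i j : (i <= j)%N ->
  (forall k, (i <= k < j)%N -> ends (e k) = [set p k; p k.+1]) ->
  walk (j - i) (p i) (p j) (\big[addb/false]_(i <= k < j) b (e k)).
Proof.
move=> ij; rewrite -(subnK ij); elim: (j - i)%N => [|d IH] H.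
  by rewrite subnn big_geq.
rewrite addSn big_nat_recr /= ?leq_addl // subSn ?leq_addl // -addn1.
apply: walk_cat; last by apply: walk1; apply: H; lia.
by apply: IH => k kP; apply: H; lia.
Qed.

Lemma nth_walk e0 n x y s : walk n x y s ->
  exists (p : nat -> mvert M) (e : nat -> medge M),
    [/\ p 0 = x, p n = y,
        forall k, (k < n)%N -> ends (e k) = [set p k; p k.+1] &
        s = \big[addb/false]_(0 <= k < n) b (e k)].
Proof.
elim: n x s => [|n IH] x s /=.
  by case=> -> ->; exists (fun=> y), (fun=> e0); rewrite big_geq.
case=> z [e [xe /IH [p [f [p0 pn pf sE]]]]].
exists (fun k => if k is k'.+1 then p k' else x).
exists (fun k => if k is k'.+1 then f k' else e); split=> //.
- by move=> [|k] //= => [_|/pf//]; rewrite p0.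
- rewrite big_nat_recl //= -sE; by case: s {sE} => //=; case: (b e).
Qed.

(** The potential of a vertex is the sum along any walk from a base vertex of its component; two
    walks with different sums would form an odd closed walk. *)
Lemma no_odd_closed_walk :
  (forall n x, ~ walk n x x true) -> coboundary.
Proof.
move=> noodd.
pose X x := [set y | exists n s, walk n y x s].
(* Bases are chosen for sets of vertices, not for vertices, so that equal components [X x] get the
   same base. *)
have /choice [r rP] : forall A : set (mvert M), exists o : option (mvert M),
    A !=set0 -> exists2 y, o = Some y & A y.
  move=> A.
  have [[y Ay]|nA] := pselect (A !=set0); first by exists (Some y) => _; exists y.
  by exists None.
have uni n m x y s t : walk n x y s -> walk m x y t -> s = t.
  move=> w1 /walk_rev w2; have := walk_cat w1 w2.
  by case: s t w1 w2 => [] [] // _ _ /noodd.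
exists (fun x => `[< exists n, if r (X x) is Some y then walk n y x true else False >]).
move=> e x y xye.
have Xxy : X x = X y.
  apply/seteqP; split=> z [n [s w]]; exists (n + 1)%N, (s (+) b e).
    exact: walk_cat w (walk1 xye).
  by apply: walk_cat w (walk1 _); rewrite set2C.
have [z rz [n [s w]]] : exists2 z, r (X x) = Some z & X x z.
  by apply: rP; exists x, 0, false.
rewrite -Xxy rz.
have w' := walk_cat w (walk1 xye).
have valE u k v : walk k z u v -> `[< exists n, walk n z u true >] = v.
  move=> wu; case: v wu => wu; first by apply/asboolP; exists k.
  by apply/negbTE/asboolP => -[m /uni/(_ wu)].
rewrite (valE _ _ _ w) (valE _ _ _ w').
by rewrite addbA addbb.
Qed.

(* A shortest closed walk of odd weight repeats no vertex and has no chord: a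
   repetition or a chord would split it into two shorter closed walks, one of
   them odd. *)
Lemma odd_chordless_cycle : ~ coboundary ->
  exists n (x : 'I_n -> mvert M) (e : 'I_n -> medge M),
    [/\ (0 < n)%N, injective x,
        forall i, ends (e i) = [set x i; x (ordS i)],
        forall i j f, i <> j -> ends f = [set x i; x j] ->
          j = ordS i \/ i = ordS j &
        \big[addb/false]_(i < n) b (e i) = true].
Proof.
move=> ncob.
have : exists n, `[< exists x, walk n x x true >].
  apply: contrapT => none; apply: ncob; apply: no_odd_closed_walk => n x w.
  by apply: none; exists n; apply/asboolP; exists x.
case/ex_minnP => n /asboolP [x0 w0] nmin.
have short m x s : (m < n)%N -> walk m x x s -> s = false.
  move=> mn; case: s => // w; have : (n <= m)%N.
    by apply: nmin; apply/asboolP; exists x.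
  by rewrite leqNgt mn.
case: n w0 nmin short => [[]//|n] w0 _ short.
have [e0 _] : exists e0 : medge M, True by case: w0 => z [e _]; exists e.
have [p [e [p0 pn pe sE]]] := nth_walk e0 w0.
(* The closed walk consists of two arcs between [p i] and [p j], whose sums differ because the total
   is odd. *)
have split i j : (i < j < n.+1)%N -> exists s,
    walk (j - i) (p i) (p j) s /\ walk (n.+1 - j + i) (p j) (p i) (~~ s).
  move=> ijn; exists (\big[addb/false]_(i <= k < j) b (e k)); split.
    by apply: walk_nth => [|k kP]; [lia|apply: pe; lia].
  have wj : walk (n.+1 - j) (p j) (p 0)
      (\big[addb/false]_(j <= k < n.+1) b (e k)).
    by rewrite p0 -pn; apply: walk_nth => [|k kP]; [lia|apply: pe; lia].
  have wi : walk (i - 0) (p 0) (p i) (\big[addb/false]_(0 <= k < i) b (e k)).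
    by apply: walk_nth => [|k kP]; [lia|apply: pe; lia].
  have := walk_cat wj wi; rewrite subn0.
  have := sE; rewrite (@big_cat_nat _ _ _ i) //=; last by lia.
  rewrite (@big_cat_nat _ _ _ j i) //=; [|lia|lia].
  by do 3 case: (\big[_/_]_(_ <= _ < _) _).
have pinj i j : (i < j < n.+1)%N -> p i <> p j.
  move=> ijn pij; have [s] := split _ _ ijn; rewrite -pij => -[w w'].
  have lt1 : (j - i < n.+1)%N by lia.
  have lt2 : (n.+1 - j + i < n.+1)%N by lia.
  by have := short _ _ _ lt2 w'; rewrite (short _ _ _ lt1 w).
(* The bound [j < i + n] excludes only [i = 0], [j = n], the pair joined by the closing edge. *)
have nochord i j f : (i.+1 < j < n.+1)%N -> (j < i + n)%N ->
    ends f = [set p i; p j] -> False.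
  move=> ijn jin fE; have ij : (i < j < n.+1)%N by lia.
  have [s [w w']] := split _ _ ij.
  have fE' := fE; rewrite set2C in fE'.
  have lt1 : (j - i + 1 < n.+1)%N by lia.
  have lt2 : (n.+1 - j + i + 1 < n.+1)%N by lia.
  have := short _ _ _ lt1 (walk_cat w (walk1 fE')).
  have := short _ _ _ lt2 (walk_cat w' (walk1 fE)).
  by case: s {w w'}; case: (b f).
have pS (i : 'I_n.+1) : p i.+1 = p (ordS i).
  rewrite /=; have := ltn_ord i; rewrite leq_eqVlt => /orP[/eqP ->|lt].
    by rewrite modnn pn p0.
  by rewrite modn_small.
exists n.+1, (fun i => p i), (fun i => e i); split=> //.
- move=> i j pij; apply: val_inj => /=; apply: contrapT => /eqP ij.
  have := ltn_ord i; have := ltn_ord j => jn iN.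
  case: (ltngtP i j) ij => // ij _; first by apply: (pinj i j) => //; lia.
  by apply: (pinj j i) => //; lia.
- by move=> i; rewrite pe // pS.
- move=> i j f.
  wlog ij : i j / (i < j)%N => [H ne fE|_ fE].
    case: (ltngtP i j) => [|ji|/val_inj//]; first by move/H; apply.
    by rewrite or_comm; apply: H => //; [exact: nesym|rewrite set2C].
  have jn := ltn_ord j.
  have [ji|ji] := eqVneq (j : nat) i.+1.
    by left; apply: val_inj; rewrite /= modn_small -?ji.
  have [jin|jin] := eqVneq (j : nat) (i + n)%N.
    right; apply: val_inj => /=.
    have -> : i = 0 :> nat by lia.
    have -> : j = n :> nat by lia.
    by rewrite modnn.
  by case: (nochord i j f) => //; lia.
- by move: sE; rewrite big_mkord => <-.
Qed.

End Walks.

(** An odd closed walk with distinct vertices is a cycle once its edges are shown to be distinct.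
    Conversely, the increments of a potential cancel around a cycle, so they cannot be the indicator
    function of one of its edges. *)
Lemma acyclicP (M : mgraph) :
  acyclic M <-> forall b : medge M -> bool, coboundary b.
Proof.
split=> [acy b|cob [k [x [e [k0 xi ei xe]]]]].
  apply: contrapT => /odd_chordless_cycle [n [x [e [n0 xi xe _ odd]]]].
  apply: acy; exists n, x, e; split=> // i j eij.
  apply: contrapT => ij.
  have := xe i; rewrite eij xe => E; case: (set2_eq E) => -[].
    by move=> /xi/esym.
  move=> /xi/esym ij' /xi ji.
  (* A repeated edge is traversed back and forth, so the walk has length 2 and its sum vanishes. *)
  have n2 : n = 2.
    have ij2 : i <> j :> nat by move/val_inj.
    have /= vi : i = ordS j :> nat by rewrite -ji.
    have /= vj : ordS i = j :> nat by rewrite ij'.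
    have := ltn_ord i; have := ltn_ord j => jn iN.
    move: vi vj; have [ei'|ei'] := eqVneq i.+1 n; have [ej|ej] := eqVneq j.+1 n;
      rewrite ?ei' ?ej ?modnn ?(@modn_small i.+1) ?(@modn_small j.+1) //; lia.
  move: odd; rewrite (bigD1 i) //= (bigD1 j) /=; last exact/eqP/nesym.
  rewrite big_pred0 ?eij ?addbF ?addbb // => l; apply/negbTE/negP.
  case/andP=> /eqP li /eqP lj; subst n.
  have := ltn_ord i; have := ltn_ord j; have := ltn_ord l => ? ? ?.
  have : i <> j :> nat by move/val_inj.
  have : l <> i :> nat by move/val_inj.
  have : l <> j :> nat by move/val_inj.
  by lia.
have [g gP] := cob (fun f => `[< f = e (Ordinal k0) >]).
have : \big[addb/false]_(i < k) (g (x i) (+) g (x (ordS i))) = true.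
  rewrite (eq_bigr (fun i => i == Ordinal k0)) => [|i _]; last first.
    by rewrite (gP _ _ _ (xe i)); apply/asboolP/eqP => [/ei|->].
  by rewrite (bigD1 (Ordinal k0)) // eqxx big1 // => i /negbTE ->.
rewrite big_split /= [X in _ (+) X](_ : _ = \big[addb/false]_(i < k) g (x i)).
  by rewrite addbb.
by rewrite [RHS](reindex_inj (@ordS_inj k)).
Qed.

(** * Connectedness, acyclicity and tree paths for sets of edges *)

Section EdgeSets.
Variable M : mgraph.
Implicit Types (S T : set (medge M)) (A : set (mvert M)).

Definition joined S x y : Prop := exists2 e, S e & ends e = [set x; y].

Definition reach S : mvert M -> mvert M -> Prop :=
  clos_refl_trans (mvert M) (joined S).

Definition connected_on T A : Prop :=
  forall x y, A x -> A y -> reach (T `&` induced_edges A) x y.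

Definition acyclic_on T A : Prop :=
  forall b : medge M -> bool, exists g : mvert M -> bool,
  forall e x y, (T `&` induced_edges A) e -> ends e = [set x; y] ->
    g x (+) g y = b e.

Lemma induced_edges2 A e x y : ends e = [set x; y] ->
  induced_edges A e <-> A x /\ A y.
Proof.
rewrite /induced_edges /= => ->; split=> [s|[Ax Ay] z [] -> //].
by split; apply: s; [left | right].
Qed.

Lemma reachS S T x y : S `<=` T -> reach S x y -> reach T x y.
Proof.
move=> ST; elim=> [u v [e Se eE]|u|u v w _ uv _ vw].
- by apply: rt_step; exists e => //; apply: ST.
- exact: rt_refl.
- exact: rt_trans uv vw.
Qed.

Lemma reach_const S (R : Type) (g : mvert M -> R) x y :
  (forall e u v, S e -> ends e = [set u; v] -> g u = g v) ->
  reach S x y -> g x = g y.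
Proof.
move=> gc; elim=> [u v [e Se eE]|//|u v w _ -> _ -> //].
exact: gc Se eE.
Qed.

(* [cut e] is a two-colouring of the vertices in which [e] is the only edge of [T]
   with ends of different colours. *)
Section Cuts.
Variables (T : set (medge M)) (cut : medge M -> mvert M -> bool).
Hypothesis cutP : forall e f x y, T f -> ends f = [set x; y] ->
  cut e x (+) cut e y = `[< f = e >].

(** In a tree these are the edges of the path between [x] and [y]. *)
Let separating x y : set (medge M) := [set e | T e /\ cut e x != cut e y].

Lemma cut_edge e x y : T e -> ends e = [set x; y] -> cut e x = ~~ cut e y.
Proof.
move=> Te /(cutP e Te); have -> : `[< e = e >] by apply/asboolP.
by case: (cut e x); case: (cut e y).
Qed.

Lemma cut_other e f x y : T f -> f <> e -> ends f = [set x; y] ->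
  cut e x = cut e y.
Proof.
move=> Tf fe /(cutP e Tf); have -> : `[< f = e >] = false by apply/asboolP.
by case: (cut e x); case: (cut e y).
Qed.

(** Induction on a walk with last edge [e] from [y'] to [z]. If [e] does not separate [x] from [y'],
    it is appended. Otherwise a walk to [y'] along separating edges has to use [e], and its part
    before the first use of [e] ends at [z]. *)
Lemma reach_separating x y : reach T x y -> reach (separating x y) x y.
Proof.
move=> xy; have {xy} := clos_rt_rtn1 _ _ _ _ xy.
elim=> [|y' z [e Te eE] _ IH]; first exact: rt_refl.
have other f : f <> e -> cut f y' = cut f z.
  by move=> fe; apply: cut_other eE => //; apply: nesym.
have [exy|exy] := boolP (cut e x == cut e y').
  apply: rt_trans (rt_step _ _ _ _ _); last first.
    exists e; last exact: eE.
    by split=> //; rewrite (eqP exy) (cut_edge Te eE); case: (cut e z).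
  apply: reachS IH => f [Tf fxy]; split=> //; rewrite -other // => fe.
  by rewrite fe exy in fxy.
have exz : cut e x = cut e z.
  by move: exy; rewrite (cut_edge Te eE); do 2 case: (cut e _).
have sub f : f <> e -> separating x y' f -> separating x z f.
  by move=> fe [Tf fxy]; split=> //; rewrite -other.
have noy : ~ reach (separating x z) x y'.
  move=> xy; case/eqP: exy; apply: reach_const xy => f u v [Tf fxz] fE.
  by apply: cut_other fE => // fe; rewrite fe exz eqxx in fxz.
suff: forall w, reach (separating x y') x w ->
    reach (separating x z) x w \/ reach (separating x z) x z.
  by move=> /(_ _ IH) [/noy|].
move=> w xw; have {xw} := clos_rt_rtn1 _ _ _ _ xw.
elim=> [|u v [f Sf fE] _ [xu|]]; last by right.
  by left; apply: rt_refl.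
have [fe|fe] := pselect (f = e); last first.
  left; apply: rt_trans xu (rt_step _ _ _ _ _).
  by exists f => //; apply: sub.
subst f; case: (set2_eq (etrans (esym eE) fE)) => -[yE zE].
  by case: noy; rewrite yE.
by right; rewrite -zE in xu.
Qed.

(** A walk inside [A] must cross the cut of each separating edge, and only that edge crosses it. *)
Lemma separating_induced A x y : connected_on T A -> A x -> A y ->
  separating x y `<=` induced_edges A.
Proof.
move=> cA Ax Ay e [Te exy]; apply: contrapT => nAe; case/eqP: exy.
apply: reach_const (cA _ _ Ax Ay) => f u v [Tf Af] fE.
by apply: cut_other fE => // fe; rewrite fe in Af.
Qed.

(** The edges separating two common vertices lie in every [B i], and they already join the two
    vertices. *)
Lemma connected_on_bigcap_cut (J : Type) (D : set J) (B : J -> set (mvert M)) :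
  connected_on T setT -> (forall i, D i -> connected_on T (B i)) ->
  connected_on T (\bigcap_(i in D) B i).
Proof.
move=> cT cB x y Bx By; have xy : reach T x y.
  by apply: reachS (cT x y I I) => e [].
apply: reachS (reach_separating xy) => e se; split; first by case: se.
move=> z ez i Di; apply: separating_induced se _ ez; first exact: cB.
  exact: Bx.
exact: By.
Qed.

End Cuts.

Lemma connected_on_bigcap T (J : Type) (D : set J) (B : J -> set (mvert M)) :
  connected_on T setT -> acyclic_on T setT ->
  (forall i, D i -> connected_on T (B i)) ->
  connected_on T (\bigcap_(i in D) B i).
Proof.
(* The cut of [e] is a potential of the indicator function of [e]. *)
move=> cT aT; have /choice [cut cutP] := fun e => aT (fun f => `[< f = e >]).
apply: (connected_on_bigcap_cut (cut := cut)) cT => e f x y Tf fE.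
by apply: cutP.
Qed.

(** Serves both spanning subgraphs and their induced subgraphs: subtypes of vertices and edges give
    way to subsets of those of [M]. Potentials are pushed forward along [phi], with value [false]
    off its range. *)
Lemma is_tree_embedding (N : mgraph) (phi : mvert N -> mvert M)
    (psi : medge N -> medge M) T A :
  injective phi -> injective psi ->
  (forall e, ends (psi e) = phi @` ends e) ->
  range phi = A -> range psi = T `&` induced_edges A ->
  is_tree N <-> connected_on T A /\ acyclic_on T A.
Proof.
move=> phi_inj psi_inj psiE <- psiT; rewrite /is_tree acyclicP.
have psi2 e x y : ends e = [set x; y] -> ends (psi e) = [set phi x; phi y].
  by move=> eE; rewrite psiE eE image_setU !image_set1.
have psi2K e x y : ends (psi e) = [set phi x; phi y] -> ends e = [set x; y].
  have [u [v eE]] := endsP e; rewrite (psi2 _ _ _ eE) eE => E.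
  by case: (set2_eq E) => -[/phi_inj -> /phi_inj ->] //; exact: set2C.
have ext (U V : Type) (f : U -> V) (g : U -> bool) u : injective f ->
    `[< exists2 u', f u' = f u & g u' >] = g u.
  move=> fi; apply/asboolP/idP => [[u' /fi ->]//|gu]; by exists u.
split=> -[con cob]; split.
- move=> _ _ [x _ <-] [y _ <-].
  elim: (con x y) => {x y} [x y [e eE]|x|x y z _ xy _ yz].
  + apply: rt_step; exists (psi e); last exact: psi2.
    by rewrite -psiT; exists e.
  + exact: rt_refl.
  + exact: rt_trans xy yz.
- move=> b; have [g gP] := cob (b \o psi).
  exists (fun x => `[< exists2 u, phi u = x & g u >]) => e x y.
  rewrite -psiT => -[f _ <-] fE; have := fE.
  have [u [v /psi2 fE']] := endsP f; rewrite fE' => E.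
  have [[xu yv]|[xv yu]] := set2_eq E; subst x y.
    by rewrite !ext //; apply: gP; apply: psi2K.
  by rewrite !ext //; apply: gP; apply: psi2K.
- move=> x y.
  have xy : reach (T `&` induced_edges (range phi)) (phi x) (phi y).
    by apply: con; [exists x | exists y].
  suff [v /phi_inj <- //] : exists2 v, phi v = phi y &
    clos_refl_trans _ (@joins N) x v.
  have {xy} := clos_rt_rtn1 _ _ _ _ xy.
  elim=> [|u w [e Te eE] _ [v vu xv]]; first by exists x => //; exact: rt_refl.
  move: Te eE; rewrite -psiT => -[f _ <-].
  have [c [d fE]] := endsP f; rewrite (psi2 _ _ _ fE) -vu => E.
  have [[/phi_inj cv <-]|[cw /phi_inj dv]] := set2_eq E; subst.
    by exists d => //; apply: rt_trans xv (rt_step _ _ _ _ _); exists f.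
  exists c => //; apply: rt_trans xv (rt_step _ _ _ _ _); exists f.
  by rewrite set2C.
- move=> b; have [g gP] := cob (fun e => `[< exists2 f, psi f = e & b f >]).
  exists (g \o phi) => e x y eE; rewrite /= (gP (psi e)) ?ext //; last exact: psi2.
  by rewrite -psiT; exists e.
Qed.

Lemma is_tree_induced T A :
  is_tree (@induced (spanning_subgraph T) A) <->
  connected_on T A /\ acyclic_on T A.
Proof.
apply: (is_tree_embedding (N := @induced (spanning_subgraph T) A)
  (phi := val) (psi := fun e => val (val e))).
- exact: val_inj.
- by move=> e f /(@val_inj _ _ (set_type T))/val_inj.
- move=> e; apply/seteqP; split=> [x ex|_ [x ex <-] //].
  have Ax : A x by apply: (set_valP e).
  by exists (exist _ x (mem_set Ax)).
- apply/seteqP; split=> [_ [x _ <-]|x Ax]; first exact: set_valP.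
  by exists (exist _ x (mem_set Ax)).
- apply/seteqP; split=> [_ [e _ <-]|e [Te Ae]].
    by split; [exact: set_valP | exact: (set_valP e)].
  pose e1 : medge (spanning_subgraph T) := exist _ e (mem_set Te).
  have Ae1 : @induced_edges (spanning_subgraph T) A e1 by [].
  by exists (exist _ e1 (mem_set Ae1)).
Qed.

Lemma is_tree_spanning T :
  is_tree (spanning_subgraph T) <-> connected_on T setT /\ acyclic_on T setT.
Proof.
apply: (is_tree_embedding (N := spanning_subgraph T) (phi := id) (psi := val)).
- by [].
- exact: val_inj.
- by move=> e; rewrite image_id.
- exact: image_id.
- apply/seteqP; split=> [_ [e _ <-]|e [Te _]].
    by split; [exact: set_valP | exact: subsetT].
  by exists (exist _ e (mem_set Te)).
Qed.

End EdgeSets.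

(** * Cocycles on chordal graphs *)

Definition edge_value (M : mgraph) (c : mvert M -> mvert M -> bool)
  (e : medge M) : bool := `[< exists u v, ends e = [set u; v] /\ c u v >].

Lemma edge_valueE (M : mgraph) (c : mvert M -> mvert M -> bool) e u v :
  ends e = [set u; v] -> c u v = c v u -> edge_value c e = c u v.
Proof.
move=> eE cC; apply/asboolP/idP => [[x [y [eE' cxy]]]|cuv].
  case: (set2_eq (etrans (esym eE) eE')) => -[uE vE]; first by rewrite uE vE.
  by rewrite cC uE vE.
by exists u, v.
Qed.

Lemma sgraph_edge (H : sgraph) (x y : H) : adj x y ->
  exists e : medge (mgraph_of H), ends e = [set x; y].
Proof.
move=> xy; have A : sedges H [set x; y] by exists x, y.
by exists (exist _ [set x; y] (mem_set A)).
Qed.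

Lemma edge_adj (H : sgraph) (e : medge (mgraph_of H)) x y :
  ends e = [set x; y] -> adj x y.
Proof.
move=> eE; have [u [v [uv eE']]] := set_valP e.
by case: (set2_eq (etrans (esym eE) eE')) => -[-> ->] //; exact: adj_sym.
Qed.

(* The clique complex of a chordal graph has trivial first cohomology. *)
Lemma chordal_cocycle (H : sgraph) (c : H -> H -> bool) : chordal H ->
  (forall x y, adj x y -> c x y = c y x) ->
  (forall x y z, adj x y -> adj y z -> adj x z -> c x y (+) c y z = c x z) ->
  exists h : H -> bool, forall x y, adj x y -> h x (+) h y = c x y.
Proof.
move=> chH cC c3; pose b := @edge_value (mgraph_of H) c.
have bE e x y : ends e = [set x; y] -> b e = c x y.
  by move=> eE; apply: edge_valueE => //; apply: cC; exact: edge_adj eE.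
have [[h hP]|] := pselect (coboundary b).
  by exists h => x y /sgraph_edge [e eE]; rewrite (hP _ _ _ eE) (bE _ _ _ eE).
move=> /odd_chordless_cycle [n [x [e [n0 xi xe chl odd]]]]; exfalso.
have xadj i : adj (x i) (x (ordS i)) by exact: edge_adj (xe i).
move: odd; rewrite (eq_bigr (fun i => c (x i) (x (ordS i)))); last first.
  by move=> i _; exact: bE.
have [n3|] := ltnP 3 n.
  case: (chH n x n3); split=> // i j; split=> [ij|[->//|->]]; last first.
    exact: adj_sym.
  have [f fE] := sgraph_edge ij; apply: chl fE => ijE.
  by rewrite ijE in ij; exact: adj_irrefl ij.
(* Lengths 1 to 3 remain: adjacency is irreflexive, an edge traversed back and forth contributes its
   value twice, and on a triangle the cocycle condition makes the sum vanish. *)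
case: n n0 x xadj {e xi xe chl} => [//|[|[|[|//]]]] _ x xadj _.
- have := xadj ord0; have -> : ordS ord0 = ord0 :> 'I_1 by exact: val_inj.
  by move/adj_irrefl.
- rewrite !big_ord_recl big_ord0 /= addbF.
  have -> : ordS (ord0 : 'I_2) = lift ord0 ord0 by exact: val_inj.
  have -> : ordS (lift ord0 ord0 : 'I_2) = ord0 by exact: val_inj.
  rewrite cC ?addbb //.
  by have := xadj ord0; have -> : ordS (ord0 : 'I_2) = lift ord0 ord0 by exact: val_inj.
- rewrite !big_ord_recl big_ord0 /= addbF.
  have := xadj ord0; have := xadj (lift ord0 ord0).
  have := xadj (lift ord0 (lift ord0 ord0)).
  have -> : ordS (ord0 : 'I_3) = lift ord0 ord0 by exact: val_inj.
  have -> : ordS (lift ord0 ord0 : 'I_3) = lift ord0 (lift ord0 ord0).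
    exact: val_inj.
  have -> : ordS (lift ord0 (lift ord0 ord0) : 'I_3) = ord0 by exact: val_inj.
  move=> a20 a12 a01; rewrite addbA c3 //; last exact: adj_sym.
  by rewrite (cC _ _ a20) addbb.
Qed.

Section Restriction.
Variables (H : sgraph) (D : set H).

(** Vertices outside [D] are kept as isolated vertices, which avoids a subtype. *)
Definition radj x y : Prop := [/\ adj x y, D x & D y].

Lemma radj_sym x y : radj x y -> radj y x.
Proof. by case=> /adj_sym xy Dx Dy; split. Qed.

Lemma radj_irrefl x : ~ radj x x.
Proof. by case=> /adj_irrefl. Qed.

Definition restriction : sgraph := SGraph radj_sym radj_irrefl.

(** A cycle contains no isolated vertex, so it stays inside [D], where adjacency is unchanged. *)
Lemma chordal_restriction : chordal H -> chordal restriction.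
Proof.
move=> chH k x k3 [xi xadj]; apply: (chH k x k3); split=> // i j.
rewrite -xadj; split=> [ij|[]//].
have D' l : D (x l).
  by have [] : radj (x l) (x (ordS l)) by apply/xadj; left.
by split.
Qed.

End Restriction.

(** * Clique trees and the families F(C) *)

Section CliqueTrees.
Variable G : sgraph.
Local Notation CG := (mgraph_of (clique_graph G)).
Implicit Types (C : set G) (K L : cliques G) (T : set (medge CG))
  (F : set (cliques G)).

Lemma complete_setU1 C v : complete G C ->
  (forall x, C x -> x <> v -> adj v x) -> complete G (v |` C).
Proof.
move=> cC vC x y /= [->|Cx] [->|Cy] // xy; first by apply: vC => //; exact: nesym.
  by apply: adj_sym; exact: vC.
exact: cC.
Qed.

Lemma complete_sub C C' : complete G C' -> C `<=` C' -> complete G C.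
Proof. by move=> cC' CC' x y /CC' C'x /CC' C'y; exact: cC'. Qed.

Lemma clique_complete K : complete G (val K).
Proof. by case: (set_valP K). Qed.

Lemma complete_meet K L : complete G (val K `&` val L).
Proof. by apply: (@complete_sub _ (val K)) => [|x []//]; exact: clique_complete. Qed.

(** The complete sets containing a vertex [v] lie in its finite closed neighbourhood [N], so each
    enlargement of [C] shrinks the complement of [C] in [N]. The empty set has no such [v], but its
    proper supersets do. *)
Lemma complete_ind (P : set G -> Prop) : locally_finite G ->
  (forall C, complete G C ->
     (forall C', complete G C' -> C `<` C' -> P C') -> P C) ->
  forall C, complete G C -> P C.
Proof.
move=> lf IH.
suff H v C : complete G C -> C v -> P C.
  move=> C cC; apply: IH => // C' cC' [_ /existsNP [v /not_implyP [C'v _]]].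
  exact: H v C' cC' C'v.
pose N : set {classic G} := v |` [set y | adj v y].
have finN : finite_set N by rewrite finite_setU; split; [exact: finite_set1|exact: lf].
have CN C' : complete G C' -> C' v -> C' `<=` N.
  move=> cC' C'v x C'x; have [->|xv] := pselect (x = v); first by left.
  by right; apply: cC' => //; exact: nesym.
have [n] := ubnP #|` fset_set (N `\` C)|; elim: n C => // n IHn C Cn cC Cv.
apply: IH => // C' cC' [CC' /existsNP [x /not_implyP [C'x nCx]]].
apply: IHn => //; last exact: CC'.
rewrite -ltnS; apply: leq_trans Cn; rewrite ltnS; apply: fproper_ltn_card.
have fin D : finite_set (N `\` D) by apply: sub_finite_set finN => y [].
rewrite fproperE; apply/andP; split.
  apply/fsubsetP => y; rewrite !in_fset_set // !inE => -[Ny nC'y].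
  by split=> // /CC'.
apply/negP => /fsubsetP /(_ x); rewrite !in_fset_set // !inE.
case=> [|_ //]; split=> //.
by apply: CN C'x => //; exact: CC'.
Qed.

Lemma complete_sub_clique C : locally_finite G -> complete G C ->
  exists K, clique_family C K.
Proof.
move=> lf; elim/complete_ind => {}C // cC IH.
have [CK|/existsNP [L /not_implyP [cL /not_implyP [CL LC]]]] :=
    pselect (forall L : set G, complete G L -> C `<=` L -> L = C).
  by exists (exist _ C (mem_set (conj cC CK))).
have [|K LK] := IH L cL; last by exists K => x /CL /LK.
by split=> // LC'; apply: LC; apply/seteqP.
Qed.

Lemma clique_family_meet K L C : clique_family C K -> clique_family C L ->
  clique_family (val K `&` val L) `<=` clique_family C.
Proof. by move=> CK CL J KLJ x Cx; apply: KLJ; split; [exact: CK | exact: CL]. Qed.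

(* [below F] is the adjacency of Gamma^<(F); [level T F e K L] says that [e] is an
   edge of Gamma^=(F) lying in [T], with ends [K] and [L]. *)
Definition below F K L : Prop := [/\ F K, F L, clique_adj K L &
  clique_family (val K `&` val L) `<` F].

Definition level T F (e : medge CG) K L : Prop :=
  [/\ T e, F K, F L, ends e = [set K; L] &
      clique_family (val K `&` val L) = F].

(** This and [quotient_acyclic] are the tree conditions on the quotient, written before contraction:
    [below] steps move inside a class, and potentials on the quotient are potentials constant along
    [below]. *)
Definition quotient_connected T F : Prop := forall K L, F K -> F L ->
  clos_refl_trans _ (fun K L => below F K L \/ exists e, level T F e K L) K L.

Definition quotient_acyclic T F : Prop := forall b : medge CG -> bool,
  exists h : cliques G -> bool,
    (forall K L, below F K L -> h K = h L) /\
    (forall e K L, level T F e K L -> h K (+) h L = b e).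

Lemma edge_below_or_level T C (e : medge CG) K L : T e ->
  clique_family C K -> clique_family C L -> ends e = [set K; L] ->
  below (clique_family C) K L \/ level T (clique_family C) e K L.
Proof.
move=> Te CK CL eE; have sub := clique_family_meet CK CL.
have [EF|ne] := pselect (clique_family (val K `&` val L) = clique_family C).
  by right.
left; split=> //; first exact: edge_adj eE.
by split=> // sub'; apply: ne; apply/seteqP.
Qed.

(** Provides the larger complete set to which the inductions over complete sets pass. *)
Lemma below_meet C K L : below (clique_family C) K L -> C `<` val K `&` val L.
Proof.
case=> CK CL _ [_ nsub]; split=> [x Cx|KLC]; first by split; [exact: CK|exact: CL].
by apply: nsub => J CJ x /KLC /CJ.
Qed.

Lemma clique_familyS C C' : C `<=` C' -> clique_family C' `<=` clique_family C.
Proof. by move=> CC' K C'K x /CC' /C'K. Qed.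

Lemma meet_family_self K L : clique_family (val K `&` val L) K /\
  clique_family (val K `&` val L) L.
Proof. by split=> x []. Qed.

Lemma reach_family T C C' K L : C `<=` C' ->
  connected_on T (clique_family C') -> clique_family C' K ->
  clique_family C' L ->
  reach (T `&` @induced_edges CG (clique_family C)) K L.
Proof.
move=> CC' con CK CL; apply: reachS (con _ _ CK CL) => e [Te eC']; split=> // J /eC'.
exact: clique_familyS.
Qed.

Lemma clique_familyE C : clique_family C =
  \bigcap_(v in C) [set K | val K v].
Proof. by apply/seteqP; split=> K CK x; exact: CK. Qed.

(** For acyclicity, take a potential of [T] with increments [b] on the level edges and 0 on the
    others. Cliques [K] and [L] related by [below] are joined in [T] inside the family of their
    meet, which contains no level edge, so the potential agrees on them. *)
Lemma clique_tree_quotients T :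
  connected_on T setT -> acyclic_on T setT ->
  (forall v, @connected_on CG T [set K | val K v]) ->
  forall C, quotient_connected T (clique_family C) /\
            quotient_acyclic T (clique_family C).
Proof.
move=> cT aT cv.
have con C : @connected_on CG T (clique_family C).
  by rewrite clique_familyE; apply: connected_on_bigcap.
move=> C; split=> [K L CK CL|b].
  elim: (con C K L CK CL) => {K L CK CL} [K L [e [Te eC] eE]|K|K L J _ KL _ LJ].
  + have /(induced_edges2 _ eE) [CK CL] := eC.
    apply: rt_step; case: (edge_below_or_level Te CK CL eE); first by left.
    by right; exists e.
  + exact: rt_refl.
  + exact: rt_trans KL LJ.
pose lev e := exists K L, level T (clique_family C) e K L.
have [g gP] := aT (fun e => b e && `[< lev e >]).
exists g; split=> [K L KL|e K L lv]; last first.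
  case: (lv) => Te CK CL eE _; rewrite (gP e K L) //.
  by have -> : `[< lev e >] by [apply/asboolP; exists K, L]; rewrite andbT.
have [KM LM] := meet_family_self K L.
apply: reach_const (con (val K `&` val L) K L KM LM) => e J J' [Te eM] eE.
have /(induced_edges2 _ eE) [MJ MJ'] := eM.
suff: g J (+) g J' = false by case: (g J); case: (g J').
rewrite (gP e J J') //.
suff -> : `[< lev e >] = false by rewrite andbF.
apply/asboolP => -[A [B [_ _ _ eE' EF]]].
have [_ _ _ [_]] := KL; apply; rewrite -EF.
have sub := clique_family_meet MJ MJ'.
case: (set2_eq (etrans (esym eE') eE)) => -[-> ->] //.
by rewrite setIC.
Qed.

(** A [below] step from [K] to [L] is replaced by a walk in the family of their meet, given by the
    induction hypothesis. *)
Lemma quotients_connected T : locally_finite G ->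
  (forall C, complete G C -> quotient_connected T (clique_family C)) ->
  forall C, complete G C -> @connected_on CG T (clique_family C).
Proof.
move=> lf qcon; apply: complete_ind => // C cC IH K L CK CL.
elim: (qcon C cC K L CK CL) => {K L CK CL} [K L|K|K L J _ KL _ LJ].
- case=> [/below_meet CM|[e [Te CK CL eE _]]]; last first.
    apply: rt_step; exists e => //; split=> //.
    by apply/(induced_edges2 _ eE).
  have [KM LM] := meet_family_self K L.
  by apply: reach_family (IH _ (@complete_meet K L) CM) KM LM; case: CM.
- exact: rt_refl.
- exact: rt_trans KL LJ.
Qed.

(* The potentials given by induction on the families of the sets [v |` C] differ,
   for adjacent [u] and [v], by a constant [c u v] on the cliques containing
   both; [c] is a cocycle on the chordal graph induced by the common neighbours
   of [C], hence the potentials can be shifted by constants [h v] so as to agree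
   wherever two of them are defined.  The result has the prescribed increments
   on the edges of [below], and the tree in the quotient corrects it on the other
   edges. *)
Lemma quotients_acyclic T : locally_finite G -> chordal G ->
  (forall C, complete G C -> @connected_on CG T (clique_family C)) ->
  (forall C, complete G C -> quotient_acyclic T (clique_family C)) ->
  forall C, complete G C -> @acyclic_on CG T (clique_family C).
Proof.
move=> lf chG con qac; apply: complete_ind => // C cC IH b.
pose D : set G := [set v | ~ C v /\ forall x, C x -> adj v x].
have KD K v : clique_family C K -> val K v -> ~ C v -> D v.
  move=> CK Kv nCv; split=> // x Cx; apply: (@clique_complete K) => //.
    exact: CK.
  by move=> vx; rewrite vx in nCv.
have cD v : D v -> complete G (v |` C).
  by case=> _ vC; apply: complete_setU1 => // x /vC.
have /choice [g gP] v : exists gv : cliques G -> bool, D v ->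
    forall (e : medge CG) K L, T e -> clique_family C K -> clique_family C L ->
      val K v -> val L v -> ends e = [set K; L] -> gv K (+) gv L = b e.
  have [Dv|nDv] := pselect (D v); last by exists (fun=> false).
  have CvC : C `<` v |` C.
    by split=> [x Cx|/(_ v)]; [right | case: Dv => nCv _ /(_ (or_introl erefl))].
  have [gv gvP] := IH _ (cD v Dv) CvC b.
  exists gv => _ e K L Te CK CL Kv Lv eE; apply: gvP => //; split=> //.
  by apply/(induced_edges2 _ eE); split=> x [->//|Cx]; [exact: CK | exact: CL].
pose H := restriction D.
(* On an edge of [T] inside the family of [u], [v] and [C] both potentials change by the same [b e],
   and this family is connected in [T]. *)
have gconst (u v : G) K L : @adj H u v -> clique_family C K -> clique_family C L ->
    val K u -> val K v -> val L u -> val L v ->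
    g u K (+) g v K = g u L (+) g v L.
  move=> [uv Du Dv] CK CL Ku Kv Lu Lv.
  have cuv : complete G (u |` (v |` C)).
    apply: complete_setU1 => [|x [->//|Cx] _]; first exact: cD.
    by case: Du => _; apply.
  have fam J : clique_family C J -> val J u -> val J v ->
      clique_family (u |` (v |` C)) J by move=> CJ Ju Jv x [->|[->|/CJ]].
  have := con _ cuv K L (fam K CK Ku Kv) (fam L CL Lu Lv).
  apply: (@reach_const CG _ bool (fun J => g u J (+) g v J)) => e A B [Te eC] eE.
  have /(induced_edges2 _ eE) [CA CB] := eC.
  have CA' : clique_family C A by move=> x Cx; apply: CA; right; right.
  have CB' : clique_family C B by move=> x Cx; apply: CB; right; right.
  have Au : val A u by apply: CA; left.
  have Av : val A v by apply: CA; right; left.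
  have Bu : val B u by apply: CB; left.
  have Bv : val B v by apply: CB; right; left.
  have := gP u Du e A B Te CA' CB' Au Bu eE.
  have := gP v Dv e A B Te CA' CB' Av Bv eE.
  by case: (b e); do 4 case: (g _ _).
pose c (u v : G) := `[< exists K,
  [/\ clique_family C K, val K u, val K v & g u K (+) g v K] >].
have cE (u v : G) K : @adj H u v -> clique_family C K -> val K u -> val K v ->
    c u v = g u K (+) g v K.
  move=> uv CK Ku Kv; apply/asboolP/idP => [[L [CL Lu Lv]]|guv].
    by rewrite (gconst u v K L).
  by exists K; split.
have csym (u v : G) : @adj H u v -> c u v = c v u.
  move=> _; congr asbool; apply/propext.
  by split=> -[K [CK Ku Kv guv]]; exists K; split=> //; rewrite addbC.
have [h hP] : exists h : G -> bool, forall u v, @adj H u v -> h u (+) h v = c u v.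
  apply: (@chordal_cocycle H) csym _; first exact: chordal_restriction.
  move=> /= u v w uv vw uw.
  (* A triangle together with [C] is complete, hence lies in a clique; evaluating the three
     potentials there gives the cocycle condition. *)
  have [K KP] : exists K, clique_family (u |` (v |` (w |` C))) K.
    apply: complete_sub_clique => //.
    case: uv vw uw => [uv [_ Du] [_ Dv]] [vw _ [nw Dw]] [uw _ _].
    apply: complete_setU1 => [|x [->//|[->//|Cx]] _]; last exact: Du.
    apply: complete_setU1 => [|x [->//|Cx] _]; last exact: Dv.
    by apply: cD.
  have CK : clique_family C K by move=> x Cx; apply: KP; do 3 right.
  have Ku : val K u by apply: KP; left.
  have Kv : val K v by apply: KP; right; left.
  have Kw : val K w by apply: KP; right; right; left.
  rewrite (cE u v K) // (cE v w K) // (cE u w K) //.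
  by do 3 case: (g _ _).
(* A clique without a vertex outside [C] gets the default [false], which is harmless because it has
   no [below] edge. *)
pose g0 K := `[< exists v, [/\ val K v, ~ C v & g v K (+) h v] >].
have g0E K v : clique_family C K -> val K v -> ~ C v ->
    g0 K = g v K (+) h v.
  move=> CK Kv nCv; apply/asboolP/idP => [[u [Ku nCu guK]]|gv]; last by exists v.
  have [->//|uv] := pselect (v = u).
  have adjvu : @adj H v u.
    by split; [exact: (@clique_complete K)|exact: KD CK Kv nCv|exact: KD CK Ku nCu].
  have := hP v u adjvu; rewrite (cE v u K) //; move: guK.
  by do 2 case: (g _ _); do 2 case: (h _).
pose d := @edge_value CG (fun K L => g0 K (+) g0 L).
have dE (e : medge CG) K L : ends e = [set K; L] -> d e = g0 K (+) g0 L.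
  by move=> eE; apply: edge_valueE => //; exact: addbC.
(* The discrepancy is made up by a potential constant along [below], so increments that are already
   right stay right. *)
have [k [kbelow klevel]] := qac C cC (fun e => b e (+) d e).
exists (fun K => g0 K (+) k K) => e K L [Te eC] eE.
have /(induced_edges2 _ eE) [CK CL] := eC.
case: (edge_below_or_level Te CK CL eE) => [below_KL|lv].
  rewrite (kbelow K L below_KL).
  have [_ /existsNP [v /not_implyP [[Kv Lv] nCv]]] := below_meet below_KL.
  rewrite (g0E K v) // (g0E L v) // -(gP v (KD K v CK Kv nCv) e K L) //.
  by do 2 case: (g _ _); case: (h _); case: (k _).
have := klevel e K L lv; rewrite (dE _ _ _ eE).
by case: (b e); do 2 case: (g0 _); do 2 case: (k _).
Qed.

Lemma clique_trees_quotients T : locally_finite G -> chordal G ->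
  ((connected_on T setT /\ acyclic_on T setT) /\
   (forall v, @connected_on CG T [set K | val K v] /\
              @acyclic_on CG T [set K | val K v])) <->
  (forall C, complete G C -> quotient_connected T (clique_family C) /\
                             quotient_acyclic T (clique_family C)).
Proof.
move=> lf chG; split=> [[[cT aT] tv] C cC|q].
  by apply: clique_tree_quotients => // v; case: (tv v).
have con := @quotients_connected T lf (fun C cC => proj1 (q C cC)).
have acy := @quotients_acyclic T lf chG con (fun C cC => proj2 (q C cC)).
(* The conditions on a clique tree are the cases [C = set0] and [C = [set v]]. *)
have fam0 : clique_family set0 = setT :> set (cliques G).
  by apply/seteqP; split=> // K _ x.
have famv (v : G) : clique_family [set v] = [set K : cliques G | val K v].
  by apply/seteqP; split=> K Kv; [exact: Kv | move=> x ->].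
split=> [|v].
  by rewrite -fam0; split; [apply: con | apply: acy] => x y [].
rewrite -famv; split; [apply: con | apply: acy] => x y -> -> //.
Qed.

End CliqueTrees.

(** * Trees in a contracted multigraph *)

Section TreeContraction.
Variables (N : mgraph) (r : mvert N -> mvert N -> Prop).
Hypothesis r_sym : forall x y, r x y -> r y x.
Local Notation R := (clos_refl_trans (mvert N) r).
Local Notation cls := (class_of R).
Variable S : set (medge N).

Lemma clos_sym x y : R x y -> R y x.
Proof.
elim=> [u v /r_sym|u|u v w _ vu _ wv]; [exact: rt_step | exact: rt_refl |].
exact: rt_trans wv vu.
Qed.

Lemma class_ofP x y : cls x = cls y <-> R x y.
Proof.
split=> [/(congr1 val) /= E|xy].
  have : class_set R y y by exact: rt_refl.
  by rewrite -E.
apply: val_inj; apply/seteqP; split=> z /=; last exact: rt_trans xy.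
by apply: rt_trans; exact: clos_sym.
Qed.

Lemma class_of_surj (X : mvert (contract R)) : exists x, cls x = X.
Proof. by have [x _ xX] := set_valP X; exists x; exact: val_inj. Qed.

Lemma ends_contract (e : medge N) x y : ends e = [set x; y] ->
  @ends (contract R) e = [set cls x; cls y].
Proof. by move=> eE; rewrite /= eE image_setU !image_set1. Qed.

(** Walks in the contraction lift by inserting [r]-walks inside the classes, and functions on the
    classes are the functions constant along [r]. *)
Lemma is_tree_contract :
  is_tree (@spanning_subgraph (contract R) S) <->
  (forall x y, clos_refl_trans _ (fun x y => r x y \/ joined S x y) x y) /\
  (forall b : medge N -> bool, exists h : mvert N -> bool,
     (forall x y, r x y -> h x = h y) /\
     (forall e x y, S e -> ends e = [set x; y] -> h x (+) h y = b e)).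
Proof.
have clos_step x y : R x y ->
    clos_refl_trans _ (fun x y => r x y \/ joined S x y) x y.
  elim=> [u v uv|u|u v w _ uv _ vw].
  - by apply: rt_step; left.
  - exact: rt_refl.
  - exact: rt_trans uv vw.
rewrite is_tree_spanning; split=> -[con acy]; split.
- move=> x y.
  suff H X Y : @reach (contract R) S X Y -> forall x y, cls x = X -> cls y = Y ->
      clos_refl_trans _ (fun x y => r x y \/ joined S x y) x y.
    by apply: (H (cls x) (cls y)) => //; apply: reachS (con _ _ I I) => e [].
  elim=> {X Y x y} [X Y [e Se eE]|X|X Y Z _ XY _ YZ] x y.
  + have [u [v eE']] := @endsP N e.
    have E := etrans (esym eE) (ends_contract eE') => xX yY; subst X Y.
    have [[/class_ofP xu /class_ofP yv]|[/class_ofP xv /class_ofP yu]] := set2_eq E.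
      apply: rt_trans (clos_step _ _ xu) _.
      apply: rt_trans (clos_step _ _ (clos_sym yv)).
      by apply: rt_step; right; exists e.
    apply: rt_trans (clos_step _ _ xv) _.
    apply: rt_trans (clos_step _ _ (clos_sym yu)).
    by apply: rt_step; right; exists e; rewrite // set2C.
  + by move=> <- /class_ofP/clos_sym/clos_step.
  + move=> xX zZ; have [w wY] := class_of_surj Y.
    exact: rt_trans (XY x w xX wY) (YZ w y wY zZ).
- move=> b; have [g gP] := acy b; exists (g \o cls); split=> [x y xy|e x y Se eE].
    by rewrite /=; congr g; apply/class_ofP; exact: rt_step.
  by apply: gP (ends_contract eE).
- move=> X Y _ _; have [x <-] := class_of_surj X; have [y <-] := class_of_surj Y.
  elim: (con x y) => {X Y x y} [x y [xy|[e Se eE]]|x|x y z _ xy _ yz].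
  + have -> : cls x = cls y by apply/class_ofP; exact: rt_step.
    exact: rt_refl.
  + by apply: rt_step; exists e => //; exact: ends_contract.
  + exact: rt_refl.
  + exact: rt_trans xy yz.
- move=> b; have [h [hr hP]] := acy b.
  have hR x y : R x y -> h x = h y.
    by elim=> [u v /hr//|//|u v w _ -> _ ->].
  exists (fun X => `[< exists2 x, cls x = X & h x >]).
  have gE x : `[< exists2 x', cls x' = cls x & h x' >] = h x.
    by apply/asboolP/idP => [[x' /class_ofP/hR <-]|hx] //; exists x.
  move=> e X Y [Se _] eE; have [u [v eE']] := @endsP N e.
  have E := etrans (esym eE) (ends_contract eE').
  have [[-> ->]|[-> ->]] := set2_eq E; rewrite !gE; first exact: hP eE'.
  by rewrite addbC; exact: hP eE'.
Qed.

End TreeContraction.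

(** * The edges of the graphs Gamma^=(F) inside the clique graph *)

Section Levels.
Variable G : sgraph.
Local Notation CG := (mgraph_of (clique_graph G)).
Implicit Types (F : set (cliques G)).

Lemma level_edge_sedge F (e : medge (mgraph_of (gamma_eq F))) :
  sedges (clique_graph G) (val @` val e).
Proof.
have [K [L [[KL _] eE]]] := set_valP e; exists (val K), (val L); split=> //.
by rewrite eE image_setU !image_set1.
Qed.

Definition level_edge F (e : medge (mgraph_of (gamma_eq F))) : medge CG :=
  exist _ (val @` val e) (mem_set (level_edge_sedge e)).

Lemma ends_level_edge F (e : medge (mgraph_of (gamma_eq F))) K L :
  ends e = [set K; L] -> ends (level_edge e) = [set val K; val L].
Proof. by move=> /= eE; rewrite eE image_setU !image_set1. Qed.

(** The family can thus be read off from the ends of an edge, so different families share no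
    edge. *)
Lemma level_edge_meet F (e : medge (mgraph_of (gamma_eq F))) (K L : cliques G) :
  ends (level_edge e) = [set K; L] -> clique_family (val K `&` val L) = F.
Proof.
have [u [v eE]] := @endsP (mgraph_of (gamma_eq F)) e.
have [_ uvF] : adj u v by exact: edge_adj eE.
rewrite (ends_level_edge eE) => E.
by case: (set2_eq E) => -[<- <-] //; rewrite setIC.
Qed.

Lemma level_edge_inj F : injective (@level_edge F).
Proof.
move=> e f /(congr1 val) /= E; apply: val_inj; apply/seteqP; split=> x ex.
  have : (val @` val e) (val x) by exists x.
  by rewrite E => -[y fy /val_inj <-].
have : (val @` val f) (val x) by exists x.
by rewrite -E => -[y fy /val_inj <-].
Qed.

Lemma level_level_edge (T : set (medge CG)) F e (K L : F) :
  level T F e (val K) (val L) <->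
  exists2 e', T (level_edge e') & level_edge e' = e /\ ends e' = [set K; L].
Proof.
split=> [[Te FK FL eE EF]|[e' Te' [<- eE]]].
  have KL : @adj (gamma_eq F) K L by split=> //; exact: edge_adj eE.
  have [e' eE'] := sgraph_edge KL.
  have E : level_edge e' = e.
    by apply: val_inj; rewrite -[LHS]/(ends (level_edge e')) (ends_level_edge eE').
  by exists e' => //; rewrite E.
have eE' := ends_level_edge eE.
split=> //; [exact: set_valP|exact: set_valP|exact: level_edge_meet eE'].
Qed.

Lemma is_tree_gamma_quotient (T : set (medge CG)) F :
  spanning_trees (gamma_quotient F) [set e | T (@level_edge F e)] <->
  quotient_connected T F /\ quotient_acyclic T F.
Proof.
rewrite /spanning_trees /= is_tree_contract; last exact: gamma_lt_adj_sym.
set S := [set e | _]; set r := @adj (gamma_lt F).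
have below_r (K L : F) : below F (val K) (val L) <-> r K L.
  split=> [[_ _ KL s]|[KL s]]; first by split.
  by split=> //; exact: set_valP.
split=> -[con acy]; split.
- move=> K L FK FL.
  have := con (exist _ K (mem_set FK)) (exist _ L (mem_set FL)).
  set x := exist _ K _; set y := exist _ L _.
  rewrite -[K]/(val x) -[L]/(val y).
  elim=> {K L FK FL x y} [x y [/below_r xy|[e Se eE]]|x|x y z _ xy _ yz].
  + by apply: rt_step; left.
  + apply: rt_step; right; exists (level_edge e); apply/level_level_edge.
    by exists e.
  + exact: rt_refl.
  + exact: rt_trans xy yz.
- move=> b; have [h [hr hP]] := acy (b \o @level_edge F).
  exists (fun K => `[< exists2 x : F, val x = K & h x >]).
  have gE (x : F) : `[< exists2 x' : F, val x' = val x & h x' >] = h x.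
    by apply/asboolP/idP => [[x' /val_inj ->]|hx] //; exists x.
  have sub K : F K -> exists x : F, K = val x.
    by move=> FK; exists (exist _ K (mem_set FK)).
  split=> [K L KL|e K L lv].
    have [FK FL _ _] := KL; move: KL.
    have [x ->] := sub K FK; have [y ->] := sub L FL => /below_r/hr.
    by rewrite !gE.
  have [_ FK FL _ _] := lv; move: lv.
  have [x ->] := sub K FK; have [y ->] := sub L FL.
  move=> /level_level_edge [e' Se' [<- eE]].
  by rewrite !gE; exact: hP.
- move=> x y; have xy := con _ _ (set_valP x) (set_valP y).
  suff [v /val_inj <- //] : exists2 v : F, val v = val y &
      clos_refl_trans _
        (fun x y => r x y \/ @joined (mgraph_of (gamma_eq F)) S x y) x v.
  have {xy} := clos_rt_rtn1 _ _ _ _ xy.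
  elim=> [|K L KL _ [v vK xv]]; first by exists x => //; exact: rt_refl.
  have FL : F L by case: KL => [[]//|[e []]].
  exists (exist _ L (mem_set FL)) => //; apply: rt_trans xv (rt_step _ _ _ _ _).
  move: KL; rewrite -vK -[L]/(val (exist _ L (mem_set FL) : F)).
  case=> [/below_r|[e /level_level_edge [e' Se' [_ eE]]]]; first by left.
  by right; exists e'.
- move=> b; have [h [hb hl]] := acy (fun e => `[< exists2 f, level_edge f = e & b f >]).
  exists (h \o val); split=> [x y /below_r/hb //|e x y Se eE].
  rewrite /= (hl (level_edge e)); last by apply/level_level_edge; exists e.
  by apply/asboolP/idP => [[f /level_edge_inj ->]|be] //; exists e.
Qed.

Lemma level_edge_eq F F' e e' : @level_edge F e = @level_edge F' e' -> F = F'.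
Proof.
have [K [L eE]] := endsP (level_edge e); move=> E.
by rewrite -(level_edge_meet eE); apply: (@level_edge_meet _ e'); rewrite -E.
Qed.

Lemma level_edge_surj (e : medge CG) :
  exists (F : clique_families G) e', @level_edge (val F) e' = e.
Proof.
have [K [L eE]] := endsP e.
have famF : clique_families G (clique_family (val K `&` val L)).
  by exists (val K `&` val L) => //; exact: complete_meet.
exists (exist _ (clique_family (val K `&` val L)) (mem_set famF)).
set F := val _; have [KM LM] := meet_family_self K L.
have : level [set: medge CG] F e (val (exist _ K (mem_set KM) : F))
    (val (exist _ L (mem_set LM) : F)) by split.
by case/level_level_edge => e' _ [E _]; exists e'.
Qed.

End Levels.

(** * The bijection *)

Theorem theorem3p5 (G : sgraph)
    (G_connected : connected (@adj G))
    (G_locally_finite : locally_finite G)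
    (G_chordal : chordal G) :
  exists f : clique_trees G ->
             (forall F : clique_families G,
                spanning_trees (gamma_quotient (val F))),
    bijective f.
Proof.
have treeP T : clique_trees G T <-> forall F : clique_families G,
    spanning_trees (gamma_quotient (val F)) [set e | T (@level_edge G (val F) e)].
  rewrite /clique_trees /= /spanning_trees /= is_tree_spanning.
  have -> : (forall v : G, is_tree (@induced (spanning_subgraph T)
      [set K : cliques G | val K v])) = (forall v : G,
      @connected_on (mgraph_of (clique_graph G)) T [set K | val K v] /\
      @acyclic_on (mgraph_of (clique_graph G)) T [set K | val K v]).
    apply/propext; split=> tv v; have := tv v;
      by rewrite (is_tree_induced T [set K : cliques G | val K v]).
  rewrite clique_trees_quotients //; split=> [q F|q C cC].
    have [C cC <-] := set_valP F.
    by apply/is_tree_gamma_quotient; exact: q.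
  have famF : clique_families G (clique_family C) by exists C.
  by apply/is_tree_gamma_quotient; exact: (q (exist _ (clique_family C) (mem_set famF))).
exists (fun T F => exist _ [set e | val T (@level_edge G (val F) e)]
  (mem_set ((treeP (val T)).1 (set_valP T) F))).
(* The inverse map takes the union of the chosen spanning trees. *)
pose U (S : forall F : clique_families G, spanning_trees (gamma_quotient (val F)))
    : set (medge (mgraph_of (clique_graph G))) :=
  [set e | exists F e', val (S F) e' /\ @level_edge G (val F) e' = e].
have US S (F : clique_families G) :
    [set e | U S (@level_edge G (val F) e)] = val (S F).
  apply/seteqP; split=> e /=; last by exists F, e.
  (* An edge determines its family, so trees chosen for other families add nothing to this trace. *)
  case=> F' [e' [Se' E]]; have /val_inj FF' := level_edge_eq E; subst F'.
  by rewrite -(level_edge_inj E).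
have Utree S : clique_trees G (U S).
  by apply/treeP => F; rewrite US; exact: set_valP.
exists (fun S => exist _ (U S) (mem_set (Utree S))) => [T|S].
  apply: val_inj; apply/seteqP; split=> e /=.
    by case=> F [e' [Te' <-]].
  by have [F [e' <-]] := level_edge_surj e => Te; exists F, e'.
apply: boolp.functional_extensionality_dep => F; apply: val_inj; exact: US.
Qed.
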